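(* Let $J$ be an adapted complex structure on the graph $\mathcal{G}$, and let $\mathcal{G}_b$ be the associated basic subgraph, with $\mathcal{G}_b=(p_1,p_2,p_3)$. Then the complex structure $J$ on $\mathfrak{n}_{\mathcal{G}}$ is $3$-step nilpotent if and only if (i) $p_2\geq 1$, and (ii) the isolated vertex of one of the copies of $\mathbb{A}_2$ (in $\mathcal{G}_b$) is not isolated when considered as a vertex of $\mathcal{G}$.
   Context: Graphs are finite and simple. For a graph $\mathcal{G}=(V,E)$ label $V=\{v_1,\dots,v_n\}$ and write $e_{i,j}$ ($i<j$) for the edge joining $v_i$ and $v_j$, if it exists. The Lie algebra $\mathfrak{n}_{\mathcal{G}}$ is the real vector space with basis $V\cup E$ and Lie bracket $[v_i,v_j]=e_{i,j}$ for $i<j$ if $v_i,v_j$ are adjacent, $[v_i,v_j]=0$ if they are not adjacent, and all elements of $E$ central. A complex structure on a real Lie algebra $\mathfrak{g}$ is a linear map $J:\mathfrak{g}\to\mathfrak{g}$ with $J^2=-\mathrm{Id}$ and $[x,y]+J([Jx,y]+[x,Jy])-[Jx,Jy]=0$ for all $x,y\in\mathfrak{g}$. An adapted complex structure on the graph $\mathcal{G}$ is a complex structure $J$ on $\mathfrak{n}_{\mathcal{G}}$ such that for every $x\in V\cup E$ either $Jx\in V\cup E$ or $-Jx\in V\cup E$. An edge is distinguished if it joins a pair of vertices $v,w$ with $w=Jv$. Associated basic subgraph: $\mathcal{G}_b$ is the spanning subgraph of $\mathcal{G}$ (same vertices) whose edges are exactly the distinguished edges of $(\mathcal{G},J)$.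 It is $J$-invariant (up to sign) and decomposes as a disjoint union of $J$-invariant subgraphs of the following types: $\mathbb{A}_1$ (two vertices $v,\pm Jv$, no edge); $\mathbb{A}_2$ (an edge $\overline{v\,w}$ with $w=Jv$, together with one further vertex $u$, isolated in $\mathcal{G}_b$, with $\pm Ju=\overline{v\,w}$); $\mathbb{A}_3$ (two disjoint edges $a$, $\pm Ja$, each of the form $\overline{v\,w}$ with $w=Jv$). The notation $\mathcal{G}_b=(p_1,p_2,p_3)$ means that there are $p_i$ copies of $\mathbb{A}_i$, $i=1,2,3$, in this decomposition. Nilpotency step: for a nilpotent Lie algebra $\mathfrak{g}$ with complex structure $J$, define $\mathfrak{a}_0=0$ and $\mathfrak{a}_k=\{x\in\mathfrak{g}\mid [x,\mathfrak{g}]\subset\mathfrak{a}_{k-1}\text{ and }[Jx,\mathfrak{g}]\subset\mathfrak{a}_{k-1}\}$ for $k\ge1$. $J$ is nilpotent if $\mathfrak{a}_k=\mathfrak{g}$ for some $k\in\mathbb{N}$; the smallest such $k$ is the nilpotency step of $J$, and $J$ is then called $k$-step nilpotent. *)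

(* Defs.v *)
From mathcomp Require Import all_boot all_order all_algebra.
From mathcomp Require Import reals.

Set Implicit Arguments.
Unset Strict Implicit.
Unset Printing Implicit Defensive.

Import Order.TTheory GRing.Theory Num.Theory.
Local Open Scope ring_scope.

Section ComplexStructure.
Variables (R : realType) (g : lmodType R).
Variables (br : g -> g -> g) (J : {linear g -> g}).

Definition complex_structure : Prop :=
  (forall x, J (J x) = - x) /\
  (forall x y, br x y + J (br (J x) y + br x (J y)) - br (J x) (J y) = 0).

(* The ascending series a_0 = 0, a_1, a_2, ... adapted to J. *)
Fixpoint J_series (k : nat) (x : g) : Prop :=
  if k is m.+1
  then (forall y, J_series m (br x y)) /\ (forall y, J_series m (br (J x) y))
  else x = 0.

Definition step_nilpotent (k : nat) : Prop :=
  (forall x, J_series k x) /\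
  (forall m, (m < k)%N -> ~ (forall x, J_series m x)).

End ComplexStructure.

(* A graph on {v_1, ..., v_n} is an adjacency relation [adj] on ['I_n]; an edge
   e_{i,j} is the pair (i, j) of its endpoints with i < j. *)
Definition edge (n : nat) (adj : rel 'I_n) : Type :=
  {p : 'I_n * 'I_n | (p.1 < p.2)%N && adj p.1 p.2}.

(* The set V \cup E. *)
Definition cell (n : nat) (adj : rel 'I_n) : Type := ('I_n + edge adj)%type.

Section GraphLieAlgebra.
Variables (R : realType) (n : nat) (adj : rel 'I_n).

(* The real vector space with basis V \cup E. *)
Definition nG : Type := {ffun cell adj -> R^o}.

Definition vtx (i : 'I_n) : cell adj := inl i.
Definition edg (f : edge adj) : cell adj := inr f.

Definition bvec (c : cell adj) : nG := [ffun d => (d == c)%:R : R^o].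

(* e_{i,j} if i < j and v_i, v_j are adjacent, and 0 otherwise. *)
Definition evec (i j : 'I_n) : nG :=
  if insub (i, j) is Some f then bvec (edg f) else 0.

(* At most one of [evec i j], [evec j i] is nonzero. *)
Definition basis_bracket (c d : cell adj) : nG :=
  match c, d with
  | inl i, inl j => evec i j - evec j i
  | _, _ => 0
  end.

Definition bracket (x y : nG) : nG :=
  \sum_c \sum_d (x c * y d) *: basis_bracket c d.

Lemma bracket_bvec (c d : cell adj) :
  bracket (bvec c) (bvec d) = basis_bracket c d.
Proof.
rewrite /bracket (bigD1 c) //= (bigD1 d) //= !ffunE !eqxx mulr1 scale1r.
rewrite !big1 ?addr0 // => i ni.
  by rewrite big1 // => j _; rewrite !ffunE (negbTE ni) mul0r scale0r.
by rewrite !ffunE (negbTE ni) mulr0 scale0r.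
Qed.

Lemma evecE (i j : 'I_n) (c : cell adj) :
  evec i j c = (if c is inr f then (val f == (i, j))%:R else 0).
Proof.
rewrite /evec; case: insubP => [f _ ef|nf].
  rewrite ffunE; case: c => [k|h] //=.
  by rewrite -ef eqE /= -val_eqE.
rewrite ffunE; case: c => // f.
case: eqP => // ef; case/negP: nf; rewrite -ef; exact: (valP f).
Qed.

Lemma bracketE (x y : nG) (c : cell adj) :
  bracket x y c =
    if c is inr f then
      x (vtx (val f).1) * y (vtx (val f).2) -
      x (vtx (val f).2) * y (vtx (val f).1)
    else 0.
Proof.
have E : bracket x y =
    \sum_i \sum_j (x (vtx i) * y (vtx j)) *: (evec i j - evec j i).
  rewrite /bracket big_sumType /= [X in _ + X]big1 ?addr0; last first.
    by move=> i _; rewrite big1 // => d _; rewrite scaler0.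
  apply: eq_bigr => i _; rewrite big_sumType /= [X in _ + X]big1 ?addr0 //.
  by move=> f _; rewrite scaler0.
rewrite E sum_ffunE; under eq_bigr => i _ do rewrite sum_ffunE.
case: c => [k|f].
  rewrite big1 // => i _; rewrite big1 // => j _.
  by rewrite !ffunE !evecE subr0 scaler0.
under eq_bigr => i _ do under eq_bigr => j _ do
  rewrite !ffunE !evecE /= scalerBr.
under eq_bigr => i _ do rewrite sumrB.
rewrite sumrB; move: f => [[a b] /= _]; congr (_ - _).
  rewrite (bigD1 a) //= (bigD1 b) //= eqxx !big1 ?addr0.
  - by rewrite /GRing.scale /= mulr1.
  - move=> i ni; rewrite big1 // => j _.
    by rewrite xpair_eqE eq_sym (negbTE ni) scaler0.
  - move=> j nj.
    by rewrite xpair_eqE [b == j]eq_sym (negbTE nj) andbF scaler0.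
rewrite (bigD1 b) //= (bigD1 a) //= eqxx !big1 ?addr0.
- by rewrite /GRing.scale /= mulr1.
- move=> i ni; rewrite big1 // => j _.
  by rewrite xpair_eqE [b == i]eq_sym (negbTE ni) andbF scaler0.
- move=> j nj.
  by rewrite xpair_eqE [a == j]eq_sym (negbTE nj) scaler0.
Qed.

End GraphLieAlgebra.

Section Adapted.
Variables (R : realType) (n : nat) (adj : rel 'I_n).
Variable J : {linear nG R adj -> nG R adj}.

Local Notation b := (@bvec R n adj).

(* J c = d or J c = - d. *)
Definition maps_pm (c d : cell adj) : bool :=
  (J (b c) == b d) || (J (b c) == - b d).

Definition adapted : Prop :=
  complex_structure (@bracket R n adj) J /\ (forall c, exists d, maps_pm c d).

Definition joins (f : edge adj) (v w : 'I_n) : bool :=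
  (val f == (v, w)) || (val f == (w, v)).

(* f joins v and w, with w = J v. *)
Definition J_joins (f : edge adj) (v w : 'I_n) : bool :=
  joins f v w && (J (b (vtx adj v)) == b (vtx adj w)).

Definition distinguished (f : edge adj) : bool :=
  [exists v, exists w, J_joins f v w].

(* Adjacency relation of the spanning subgraph G_b. *)
Definition basic_adj : rel 'I_n :=
  fun v w => [exists f : edge adj, distinguished f && joins f v w].

Definition isolated (e : rel 'I_n) (u : 'I_n) : bool := [forall w, ~~ e u w].

(* Copies of A_1, A_2, A_3 in G_b are subgraphs, encoded as the sets of their
   vertices and edges.  Such a copy is the only one containing any given one of
   its cells, so the copies are the blocks of the decomposition of G_b. *)
Definition copy_A1 (S : {set cell adj}) : bool :=
  [exists v, exists w,
    [&& S == [set vtx adj v; vtx adj w],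
        maps_pm (vtx adj v) (vtx adj w) & ~~ basic_adj v w]].

Definition copy_A2 (S : {set cell adj}) : bool :=
  [exists v, exists w, exists u, exists f : edge adj,
    [&& S == [set vtx adj v; vtx adj w; edg f; vtx adj u],
        J_joins f v w, isolated basic_adj u & maps_pm (vtx adj u) (edg f)]].

Definition copy_A3 (S : {set cell adj}) : bool :=
  [exists v, exists w, exists f : edge adj,
   exists v', exists w', exists f' : edge adj,
    [&& S == [set vtx adj v; vtx adj w; edg f;
                  vtx adj v'; vtx adj w'; edg f'],
        J_joins f v w, J_joins f' v' w', uniq [:: v; w; v'; w']
      & maps_pm (edg f) (edg f')]].

(* G_b = (p1, p2, p3). *)
Definition basic_type (p1 p2 p3 : nat) : Prop :=
  [/\ #|[set S | copy_A1 S]| = p1,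
      #|[set S | copy_A2 S]| = p2
    & #|[set S | copy_A3 S]| = p3].

End Adapted.

(* Main.v *)
(** For any complex structure on a Lie algebra whose brackets are all central,
    a_3 is everything: if t is a bracket and z = J t, then J z is central, so
    integrability gives [z,y] + J [z, J y] = 0 and hence [z,y] lies in a_1.
    So J is 3-step iff a_2 is proper, i.e. iff J sends some edge e to a
    non-central basis vector: plus or minus a vertex u, not isolated in G.
    If e joins v and w, the e-coordinate of the integrability condition for v, w
    forces [Jv, Jw] to have a nonzero e-component, hence Jv = w or Jw = v; so e
    is distinguished, and e and u span a copy of A_2. *)
Require Import Defs.
From mathcomp Require Import all_boot all_order all_algebra.
From mathcomp Require Import reals.

Set Implicit Arguments.
Unset Strict Implicit.
Unset Printing Implicit Defensive.

Import Order.TTheory GRing.Theory Num.Theory.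
Local Open Scope ring_scope.

(** * The bracket in coordinates *)

Section GraphBracket.
Variables (R : realType) (n : nat) (adj : rel 'I_n).
Local Notation b := (@bvec R n adj).
Local Notation br := (@bracket R n adj).
Implicit Types (x y : nG R adj) (c d : cell adj) (f : edge adj).

Lemma bvecE c d : b c d = (d == c)%:R.
Proof. by rewrite ffunE. Qed.

Lemma eq_vtx i j : (vtx adj i == vtx adj j) = (i == j).
Proof. by []. Qed.

Lemma eq_edg f h : (edg f == edg h) = (val f == val h).
Proof. by []. Qed.

Lemma nG_oppE x c : (- x) c = - x c.
Proof. by rewrite ffunE. Qed.

Lemma nG_addE x y c : (x + y) c = x c + y c.
Proof. by rewrite ffunE. Qed.

Lemma nG_zeroE c : (0 : nG R adj) c = 0.
Proof. by rewrite ffunE. Qed.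

Lemma nG_bvec_sum x : x = \sum_c x c *: b c.
Proof.
apply/ffunP => d; rewrite sum_ffunE (bigD1 d) //= big1 => [|c cd].
  by rewrite addr0 !ffunE eqxx /GRing.scale /= mulr1.
by rewrite !ffunE eq_sym (negbTE cd) scaler0.
Qed.

Lemma bvec_inj : injective b.
Proof.
move=> c d /ffunP/(_ c); rewrite !bvecE eqxx.
by case: eqP => // _ /eqP; rewrite oner_eq0.
Qed.

Lemma bvec_neq_opp c d : b c <> - b d.
Proof.
move=> /ffunP/(_ c); rewrite nG_oppE !bvecE eqxx => /eqP; apply/negP.
by case: (c == d); rewrite ?oppr0 ?oner_eq0 // -subr_eq0 opprK -natrD pnatr_eq0.
Qed.

Lemma bracket_vtx x y i : br x y (vtx adj i) = 0.
Proof. by rewrite bracketE. Qed.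

Lemma bracket_edg x y f :
  br x y (edg f) = x (vtx adj (val f).1) * y (vtx adj (val f).2) -
                   x (vtx adj (val f).2) * y (vtx adj (val f).1).
Proof. by rewrite bracketE. Qed.

(** The bracket reads only vertex coordinates, so edges, and hence all brackets, are central. *)
Lemma bracket_central x y : (forall i, x (vtx adj i) = 0) -> br x y = 0.
Proof.
move=> x0; apply/ffunP => -[i|f].
  by rewrite (bracket_vtx x y i) nG_zeroE.
by rewrite (bracket_edg x y f) !x0 !mul0r subr0 nG_zeroE.
Qed.

Lemma edge_neq f : (val f).1 != (val f).2.
Proof. by have /andP[/ltn_eqF/negbT] := valP f. Qed.

Lemma bracket_endpoints f :
  br (b (vtx adj (val f).1)) (b (vtx adj (val f).2)) = b (edg f).
Proof.
rewrite bracket_bvec /=; apply/ffunP => d.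
rewrite nG_addE nG_oppE !evecE bvecE; case: d => [i|h]; first by rewrite subr0.
rewrite -surjective_pairing eq_edg.
suff /negbTE-> : val h != ((val f).2, (val f).1) by rewrite subr0.
apply: contraTneq (valP h) => -> /=; rewrite negb_and -leqNgt ltnW //.
by case/andP: (valP f).
Qed.

Lemma joins_bvec_bracket f v w :
  joins f v w -> br (b (vtx adj v)) (b (vtx adj w)) (edg f) != 0.
Proof.
move=> /orP fvw; have := edge_neq f; rewrite bracket_edg !bvecE.
case: fvw => /eqP-> /= vw; rewrite !eq_vtx !eqxx (negbTE vw).
  by rewrite mulr0 subr0 mulr1 oner_eq0.
by rewrite mul0r mulr1 sub0r oppr_eq0 oner_eq0.
Qed.

End GraphBracket.

Lemma joins_adj n (adj : rel 'I_n) (f : edge adj) v w :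
  symmetric adj -> joins f v w -> adj v w.
Proof.
move=> sym /orP[] /eqP fE; have /andP[_] := valP f; rewrite fE //=.
by rewrite sym.
Qed.

(** An edge is stored with its smaller endpoint first: symmetry handles the reversed order,
    irreflexivity excludes [v = w]. *)
Lemma adj_edge n (adj : rel 'I_n) v w :
  symmetric adj -> irreflexive adj -> adj v w -> exists f : edge adj, joins f v w.
Proof.
move=> sym irr vw; case: (ltngtP v w) => [lvw|lwv|/val_inj vE].
- have p : ((v, w).1 < (v, w).2)%N && adj (v, w).1 (v, w).2 by rewrite lvw.
  by exists (exist _ (v, w) p); rewrite /joins eqxx.
- have p : ((w, v).1 < (w, v).2)%N && adj (w, v).1 (w, v).2 by rewrite lwv sym.
  by exists (exist _ (w, v) p); rewrite /joins eqxx orbT.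
- by move: vw; rewrite vE irr.
Qed.

Section AdaptedStructure.
Variables (R : realType) (n : nat) (adj : rel 'I_n).
Variable J : {linear nG R adj -> nG R adj}.
Local Notation b := (@bvec R n adj).
Local Notation br := (@bracket R n adj).
Local Notation V i := (vtx adj i).
Implicit Types (x y : nG R adj) (c d : cell adj) (f : edge adj) (u v w : 'I_n).

(** * The ascending series *)

Lemma J_series_mono k x : J_series br J k x -> J_series br J k.+1 x.
Proof.
elim: k x => [x ->|k IH x [Hx HJx]].
  by split=> y; rewrite ?linear0; apply: bracket_central => i; rewrite nG_zeroE.
by split=> y; [exact: (IH _ (Hx y)) | exact: (IH _ (HJx y))].
Qed.

Lemma J_series1_central x :
  (forall i, x (V i) = 0) -> (forall i, J x (V i) = 0) -> J_series br J 1 x.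
Proof. by move=> x0 Jx0; split=> y; apply: bracket_central. Qed.

Lemma J_series3_full : complex_structure br J -> forall x, J_series br J 3 x.
Proof.
move=> [JJ integrable].
have step2 z y : (forall i, J z (V i) = 0) -> J_series br J 1 (br z y).
  move=> Jz0; have := integrable z y.
  rewrite !(bracket_central (x := J z)) // add0r subr0.
  (* Applying [J] to [z,y] + J[z,Jy] = 0 gives J[z,y] = [z,Jy]. So J[z,y] is itself a bracket, which
     puts [z,y] in a_1. *)
  move/(congr1 J); rewrite linearD linear0 JJ => /eqP.
  rewrite subr_eq0 => /eqP JzE.
  by apply: J_series1_central => i; rewrite ?JzE bracket_vtx.
have bracket2 x y : J_series br J 2 (br x y).
  split=> z; last by apply: step2 => i; rewrite JJ nG_oppE bracket_vtx oppr0.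
  rewrite bracket_central => [|i]; last exact: bracket_vtx.
  by apply: J_series_mono.
by move=> x; split=> y; apply: bracket2.
Qed.

(** Since a_3 is everything and a_0, a_1 lie in a_2, minimality of 3 reduces to a_2 being proper. *)
Lemma step3E : complex_structure br J ->
  step_nilpotent br J 3 <-> ~ (forall x, J_series br J 2 x).
Proof.
move=> cJ; split=> [[_ min3]|a2]; first exact: min3.
split=> [|m]; first exact: J_series3_full.
case: m => [|[|[|//]]] _ am; apply: a2 => x.
- exact: (J_series_mono (J_series_mono (am x))).
- exact: (J_series_mono (am x)).
- exact: am.
Qed.

(** * [J] as a signed permutation of the cells *)

Lemma maps_pm_sym c d : complex_structure br J -> maps_pm J c d -> maps_pm J d c.
Proof.
move=> [JJ _] /orP[] /eqP E; apply/orP; [right|left]; apply/eqP.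
  by rewrite -JJ E.
by rewrite -[b d]opprK -E linearN JJ opprK.
Qed.

Lemma maps_pm_fun c d d' : maps_pm J c d -> maps_pm J c d' -> d = d'.
Proof.
move=> /orP[] /eqP E /orP[] /eqP; rewrite E.
- exact: bvec_inj.
- by move/bvec_neq_opp.
- by move/esym/bvec_neq_opp.
- by move/oppr_inj/bvec_inj.
Qed.

(** If J c = c or J c = -c, then J(J c) = c, which is not -c. *)
Lemma maps_pm_irr c : complex_structure br J -> ~~ maps_pm J c c.
Proof.
move=> [JJ _]; apply/negP => /orP[] /eqP E; have := JJ (b c).
  by rewrite !E => /bvec_neq_opp.
by rewrite E linearN E opprK => /bvec_neq_opp.
Qed.

Lemma J_coord c d : adapted J -> J (b c) d != 0 -> maps_pm J c d.
Proof.
move=> [_ /(_ c) [e ce]] cd; suff -> : d = e by [].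
apply/eqP; apply: contraNT cd => de.
by case/orP: ce => /eqP->; rewrite ?nG_oppE bvecE (negbTE de) ?oppr0.
Qed.

Lemma J_coord0 x d : adapted J ->
  (forall c, maps_pm J c d -> x c = 0) -> J x d = 0.
Proof.
move=> aJ x0; rewrite [x]nG_bvec_sum linear_sum sum_ffunE big1 // => c _.
rewrite linearZ /= ffunE; have [->|/(J_coord aJ)/x0->] := eqVneq (J (b c) d) 0.
  exact: scaler0.
exact: scale0r.
Qed.

Lemma J_joins_maps_pm f v w : J_joins J f v w -> maps_pm J (V v) (V w).
Proof. by rewrite /maps_pm => /andP[_ ->]. Qed.

(** * Vertices that [J] exchanges with edges *)

Lemma vertex_image_edge_distinguished f u : adapted J ->
  maps_pm J (V u) (edg f) -> exists v w, J_joins J f v w.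
Proof.
move=> aJ uf; have [cJ _] := aJ; have [JJ integrable] := cJ.
set v := (val f).1; set w := (val f).2.
suff /orP[vw|vw] : maps_pm J (V v) (V w).
- by exists v, w; rewrite /J_joins vw /joins -surjective_pairing eqxx.
(* [J_joins] fixes the sign: J v = -w means J w = v, so the endpoints swap roles. *)
- exists w, v; rewrite /J_joins /joins -surjective_pairing eqxx orbT /=.
  by rewrite -[b (V w)]opprK -(eqP vw) linearN JJ opprK.
have := integrable (b (V v)) (b (V w)); rewrite bracket_endpoints.
move/ffunP/(_ (edg f)); rewrite nG_zeroE !nG_addE nG_oppE bvecE eqxx.
(* The middle term has no [f]-coordinate: only the cell [u] maps to [f] up to sign, and brackets
   have no vertex coordinates. *)
rewrite (J_coord0 aJ) => [|c cf]; last first.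
  have uc : V u = c.
    by apply: maps_pm_fun (maps_pm_sym cJ uf) (maps_pm_sym cJ cf).
  by rewrite -uc nG_addE !bracket_vtx addr0.
rewrite bracket_edg -/v -/w addr0 => /eqP; rewrite subr_eq0 => /eqP E.
(* [E] reads 1 = (Jv)_v (Jw)_w - (Jv)_w (Jw)_v. As (Jv)_v = 0, the coordinate (Jv)_w cannot
   vanish. *)
apply: (J_coord aJ); apply: contra_eq_neq E => ->.
have /eqP-> : J (b (V v)) (V v) == 0.
  by apply: contraT => /(J_coord aJ) vv; have := maps_pm_irr (V v) cJ; rewrite vv.
by rewrite !mul0r subr0 oner_eq0.
Qed.

(** [J] sends the ends of a distinguished edge to vertices, but [u] to an edge. *)
Lemma vertex_image_edge_isolated f u : complex_structure br J ->
  maps_pm J (V u) (edg f) -> isolated (basic_adj J) u.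
Proof.
move=> cJ uf; apply/forallP => z; apply/negP => /existsP[h /andP[]].
move=> /existsP[v /existsP[w hvw]].
have vw := J_joins_maps_pm hvw; have wv := maps_pm_sym cJ vw.
case/andP: hvw => /orP hvw _ /orP huz.
by case: hvw huz => /eqP-> [] /eqP[] vE wE; subst;
  first [have := maps_pm_fun uf vw | have := maps_pm_fun uf wv].
Qed.

(** The vertex coordinates of J[x,y] sit only at vertices exchanged with edges. By hypothesis no
    edge of the graph ends there, so J[x,y] is central and [x,y] lies in a_1. *)
Lemma J_series2_full : adapted J ->
  (forall u f, maps_pm J (V u) (edg f) -> isolated adj u) -> symmetric adj ->
  forall x, J_series br J 2 x.
Proof.
move=> aJ iso sym; have [cJ _] := aJ.
suff a1 x y : J_series br J 1 (br x y) by move=> x; split.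
split=> z; first by apply: bracket_central => i; rewrite bracket_vtx.
have J0 u u' f : joins f u u' -> J (br x y) (V u) = 0.
  move=> fu; apply: (J_coord0 aJ) => -[i|h] hu.
    exact: (bracket_vtx x y i).
  have /forallP/(_ u') := iso u h (maps_pm_sym cJ hu).
  by rewrite (joins_adj sym fu).
apply/ffunP => -[i|f]; first by rewrite (bracket_vtx _ _ i) nG_zeroE.
rewrite (bracket_edg _ _ f) nG_zeroE (J0 _ (val f).2 f) ?(J0 _ (val f).1 f).
  by rewrite !mul0r subr0.
all: by rewrite /joins -surjective_pairing eqxx ?orbT.
Qed.

(** If an endpoint of [f] were in a_2, then [f] would be in a_1 and J f, which is [u] up to sign,
    would be central; but [u] has a neighbour. *)
Lemma J_series2_proper f u : complex_structure br J -> symmetric adj ->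
  irreflexive adj -> maps_pm J (V u) (edg f) -> ~~ isolated adj u ->
  ~ (forall x, J_series br J 2 x).
Proof.
move=> cJ sym irr uf /forallPn[w]; rewrite negbK => /(adj_edge sym irr).
move=> [h huw] /(_ (b (V (val f).1)))[/(_ (b (V (val f).2))) + _].
rewrite bracket_endpoints => -[_ /(_ (b (V w)))] /= /ffunP/(_ (edg h)).
rewrite nG_zeroE => /eqP; apply/negP; move: (joins_bvec_bracket R huw).
rewrite !bracket_edg; have /orP[] := maps_pm_sym cJ uf => /eqP-> //.
by rewrite !nG_oppE !mulNr -opprD oppr_eq0.
Qed.

End AdaptedStructure.

Theorem proposition6p7 (R : realType) (n : nat) (adj : rel 'I_n)
    (adj_sym : symmetric adj) (adj_irr : irreflexive adj)
    (J : {linear nG R adj -> nG R adj}) (p1 p2 p3 : nat)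
    (J_adapted : adapted J) (J_type : basic_type J p1 p2 p3) :
  step_nilpotent (@bracket R n adj) J 3 <->
  (1 <= p2)%N /\
  exists S : {set cell adj}, copy_A2 J S /\
    exists u : 'I_n,
      [/\ vtx adj u \in S, isolated (basic_adj J) u & ~~ isolated adj u].
Proof.
have [cJ _] := J_adapted; rewrite (step3E cJ); split; last first.
  move=> [_ [S [+ [u [uS ub uG]]]]].
  move=> /existsP[v /existsP[w /existsP[u' /existsP[f /and4P[/eqP SE fvw _ uf]]]]].
  have df : distinguished J f by apply/existsP; exists v; apply/existsP; exists w.
  have /andP[jf _] := fvw.
  have nbasic z : ~~ joins f u z.
    by apply: contraTN (forallP ub z) => fu; rewrite negbK; apply/existsP; exists f;
      rewrite df.
  (* The other two vertices of [S] are ends of the distinguished edge [f], hence not isolated in the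
     basic subgraph. *)
  have uu : u = u'.
    move: uS; rewrite SE !inE => /orP[/orP[/orP[]|]|] /eqP // [uE].
    - by case/negP: (nbasic w); rewrite uE.
    - by case/negP: (nbasic v); rewrite uE /joins orbC.
    - by [].
  by apply: J_series2_proper cJ adj_sym adj_irr _ uG; rewrite uu; apply: uf.
move=> a2.
(* Boolean quantifiers over finite types let a witness be drawn from the negation [a2]. *)
have /existsP[u /existsP[f /andP[uf uG]]] :
    [exists u, exists f : edge adj,
       maps_pm J (vtx adj u) (edg f) && ~~ isolated adj u].
  apply: contra_notT a2 => /existsPn noedge.
  apply: J_series2_full => // u f uf; apply: contraT => uG.
  by have /existsPn/(_ f) := noedge u; rewrite uf uG.
have [v [w fvw]] := vertex_image_edge_distinguished J_adapted uf.
have ub := vertex_image_edge_isolated cJ uf.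
pose S := [set vtx adj v; vtx adj w; edg f; vtx adj u].
have SA2 : copy_A2 J S.
  apply/existsP; exists v; apply/existsP; exists w; apply/existsP; exists u.
  by apply/existsP; exists f; rewrite eqxx fvw ub uf.
split; last by exists S; split=> //; exists u; split; rewrite // !inE eqxx orbT.
by case: J_type => _ <- _; apply/card_gt0P; exists S; rewrite inE.
Qed.
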